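(* Suppose the posterior density is a Gaussian mixture $p(\theta\mid\mathcal D)=\sum_{k=1}^K a_k\,\mathrm{MVN}_R(\theta;m_k,S_k)$ with $a_k>0$, $\sum_k a_k=1$, and $S_k$ positive definite. Let $T$ be even and $\theta^{(T/2+1)},\dots,\theta^{(T)}$ independent draws from the posterior. For weights $\omega_1,\dots,\omega_K\ge0$ summing to $1$ and measurable sets $A_1,\dots,A_K$ of finite positive volume, define $$\hat Z^{-1}_{\mathrm{Mix}}=\sum_{k=1}^K\omega_k\frac{1}{T/2}\sum_{\substack{t=T/2+1\\\theta^{(t)}\in A_k}}^T\frac{1/V(A_k)}{\pi(\theta^{(t)})L(\theta^{(t)})}.$$ Then $$\operatorname{Var}[\hat Z^{-1}_{\mathrm{Mix}}\mid\mathcal D]\le U(\omega,A):=\frac{K Z^{-2}}{T/2}\sum_{k=1}^K\frac{\omega_k^2}{a_k}\int_{A_k}\frac{1/V(A_k)^2}{\mathrm{MVN}_R(\theta;m_k,S_k)}\,d\theta-\frac{Z^{-2}}{T/2},$$ and this upper bound $U$ is minimised over all such weights and sets by $A_k=E_{m_k,S_k,c_R}$ and $\omega_k=a_k$, $k=1,\dots,K$.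
   Context: $Z=\int\pi L$ is the marginal likelihood and $p(\theta\mid\mathcal D)=\pi(\theta)L(\theta)/Z$. $\mathrm{MVN}_R(\theta;m,S)$ is the $R$-dimensional normal density with mean $m$ and covariance $S$. $V$ denotes Lebesgue volume. The ellipsoid $E_{m,S,c}=\{\theta:(\theta-m)^\top S^{-1}(\theta-m)<c^2\}$. The constant $c_R>0$ is the minimiser over $c>0$ of $V(E_{0,I_R,c})^{-2}\int_{E_{0,I_R,c}}\mathrm{MVN}_R(\theta;0,I_R)^{-1}\,d\theta$ (the optimal radius for a truncated harmonic mean estimator under an exactly standard normal posterior; it satisfies $c_R/\sqrt{R+1}\to1$ as $R\to\infty$). *)

(* Defs.v *)
From HB Require Import structures.
From mathcomp Require Import all_boot all_order all_algebra.
From mathcomp Require Import all_classical all_reals all_analysis.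
Set Implicit Arguments. Unset Strict Implicit. Unset Printing Implicit Defensive.
Import Order.TTheory GRing.Theory Num.Theory.
Import numFieldNormedType.Exports.
Local Open Scope classical_set_scope.
Local Open Scope ring_scope.

Definition box (R : realType) (n : nat) (a b : 'rV[R]_n) : set 'rV[R]_n :=
  [set x | forall i, a ord0 i < x ord0 i <= b ord0 i].

Definition boxes (R : realType) (n : nat) : set (set 'rV[R]_n) :=
  [set B | exists a b, B = box a b].

(* R^n with its Borel sigma-algebra (generated by the half-open boxes). *)
Notation Rvec R n := (g_sigma_algebraType (@boxes R n)).

(* lam is Lebesgue measure on R^n: it gives every box its volume.
   (Such a measure exists and is unique on the Borel sets.) *)
Definition is_lebesgue (R : realType) (n : nat)
  (lam : {measure set (Rvec R n) -> \bar R}) : Prop :=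
  forall a b : 'rV[R]_n, (forall i, a ord0 i <= b ord0 i) ->
    lam (box a b : set (Rvec R n)) = (\prod_i (b ord0 i - a ord0 i))%:E.

Definition mahal (R : realType) (n : nat) (x m : 'rV[R]_n) (S : 'M[R]_n) : R :=
  ((x - m) *m invmx S *m (x - m)^T) ord0 ord0.

Definition posdef (R : realType) (n : nat) (S : 'M[R]_n) : Prop :=
  S^T = S /\ forall x : 'rV[R]_n, x != 0 -> 0 < (x *m S *m x^T) ord0 ord0.

Definition MVN (R : realType) (n : nat) (x m : 'rV[R]_n) (S : 'M[R]_n) : R :=
  (Num.sqrt ((2 * pi) ^+ n * \det S))^-1 * expR (- (mahal x m S) / 2).

Definition ellipsoid (R : realType) (n : nat) (m : 'rV[R]_n) (S : 'M[R]_n) (c : R)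
  : set (Rvec R n) := [set x | mahal x m S < c ^+ 2].

Definition mixture (R : realType) (n K : nat) (a : 'I_K -> R)
  (m : 'I_K -> 'rV[R]_n) (S : 'I_K -> 'M[R]_n) (x : 'rV[R]_n) : R :=
  \sum_(k < K) a k * MVN x (m k) (S k).

Definition cR_objective (R : realType) (n : nat)
  (lam : {measure set (Rvec R n) -> \bar R}) (c : R) : \bar R :=
  (\int[lam]_(x in ellipsoid 0 1%:M c)
     ((fine (lam (ellipsoid 0 1%:M c)))^-2 / MVN x 0 1%:M)%:E)%E.

Definition mutually_independent {d} (Omega : measurableType d) (R : realType)
  (P : probability Omega R) (n N : nat) (X : 'I_N -> Omega -> Rvec R n) : Prop :=
  forall B : 'I_N -> set (Rvec R n), (forall t, measurable (B t)) ->
    P (\bigcap_(t in [set: 'I_N]) (X t @^-1` B t)) = (\prod_(t < N) P (X t @^-1` B t))%E.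

(* the mixture estimator  hat Z^{-1}_Mix  (N = T/2 draws) *)
Definition Zinv_mix (R : realType) (n K N : nat)
  (lam : {measure set (Rvec R n) -> \bar R})
  (piL : Rvec R n -> R) (w : 'I_K -> R) (A : 'I_K -> set (Rvec R n))
  {Omega : Type} (X : 'I_N -> Omega -> Rvec R n) (o : Omega) : R :=
  \sum_(k < K) w k * (N%:R^-1 *
     \sum_(t < N | `[< A k (X t o) >]) ((fine (lam (A k)))^-1 / piL (X t o))).

Definition Ubound (R : realType) (n K N : nat)
  (lam : {measure set (Rvec R n) -> \bar R}) (Z : R)
  (a : 'I_K -> R) (m : 'I_K -> 'rV[R]_n) (S : 'I_K -> 'M[R]_n)
  (w : 'I_K -> R) (A : 'I_K -> set (Rvec R n)) : \bar R :=
  ((K%:R * Z ^- 2 / N%:R)%:E *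
     (\sum_(k < K) (w k ^+ 2 / a k)%:E *
        \int[lam]_(x in A k) ((fine (lam (A k)))^-2 / MVN x (m k) (S k))%:E)
   - (Z ^- 2 / N%:R)%:E)%E.

Definition admissible (R : realType) (n K : nat)
  (lam : {measure set (Rvec R n) -> \bar R})
  (w : 'I_K -> R) (A : 'I_K -> set (Rvec R n)) : Prop :=
  (forall k, 0 <= w k) /\ \sum_(k < K) w k = 1 /\
  (forall k, measurable (A k) /\ (0 < lam (A k))%E /\ (lam (A k) < +oo)%E).
Arguments Zinv_mix {R n K N} lam piL w A {Omega} X o.

(* Main.v *)
Require Import Defs.
From HB Require Import structures.
From mathcomp Require Import all_boot all_order all_algebra.
From mathcomp Require Import all_classical all_reals all_analysis measurable_realfun.
From mathcomp Require Import ring lra.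
Import Order.TTheory GRing.Theory Num.Theory.
Import numFieldNormedType.Exports.
Local Open Scope classical_set_scope.
Local Open Scope ring_scope.

(* The variance of an average of independent copies of a summand [f] is
   (E f^2 - (E f)^2) / N with E f = 1/Z, and E f^2 is bounded pointwise under the
   integral by Cauchy-Schwarz with the weights a_k MVN_k.  For the optimality, the
   bound splits over k: sum w_k^2 / a_k >= 1 by Cauchy-Schwarz again, and each
   functional V(A)^-2 \int_A 1/MVN_k is, by the bathtub principle, smaller on the
   ellipsoid of the same volume as A; an affine change of variables turns its value
   on that ellipsoid into the one-dimensional objective minimised by c_R.

   The change of variables formula for Lebesgue measure on R^n is only needed for a
   matrix M with M S M^T = 1, which can be chosen as a product of diagonal matrices
   and transvections.  That transvections preserve volume is obtained by cutting a box
   into thin slabs, on which the sheared box is close to a box. *)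

(** * Measurability on R^n *)

Lemma measurable_box {R : realType} {n : nat} (a b : 'rV[R]_n) :
  measurable (box a b : set (Rvec R n)).
Proof. by apply: sub_sigma_algebra; exists a, b. Qed.

Lemma coord_le_bound {R : realType} {n : nat} (x : 'rV[R]_n) :
  exists k : nat, forall i, `|x ord0 i| <= k%:R.
Proof.
exists (Num.Def.archi_bound (\sum_i `|x ord0 i|)) => i.
apply: ltW; apply: le_lt_trans (archi_boundP _); last by apply: sumr_ge0.
by rewrite (bigD1 i)//= lerDl sumr_ge0.
Qed.

Lemma measurable_coord {R : realType} {n : nat} (i : 'I_n) :
  measurable_fun [set: Rvec R n] (fun x : Rvec R n => (x : 'rV[R]_n) ord0 i).
Proof.
apply: (measurability _ (RGenOInfty.measurableE R)).
move=> _ [_ [a ->] <-]; rewrite setTI.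
set f := fun x : Rvec R n => _.
(* The open half-space is exhausted by boxes with lower corner [a] in direction [i]. Since boxes are
   open below, [|x_j| <= k] only gives membership with the larger bound [k.+1]. *)
rewrite (_ : f @^-1` _ = \bigcup_(k : nat)
  (box (\row_j if j == i then a else - k.+1%:R) (const_mx k.+1%:R) : set (Rvec R n))).
  by apply: bigcupT_measurable => k; exact: measurable_box.
apply/seteqP; split=> [x /=|x [k _ /= xk]]; last first.
  by have := xk i; rewrite !mxE eqxx in_itv/= andbT => /andP[].
rewrite in_itv/= andbT => ax; have [k xk] := coord_le_bound x.
exists k => // j; have := xk j; rewrite !mxE ler_norml => /andP[kx xk'].
have kk : k%:R < k.+1%:R :> R by rewrite ltr_nat.
rewrite (le_trans xk' (ltW kk)) andbT; case: eqP => [->//|_].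
by rewrite (lt_le_trans _ kx)// ltrN2.
Qed.

Lemma measurable_fun_rV {d} {T : measurableType d} {R : realType} {n : nat}
    (f : T -> Rvec R n) :
  (forall i, measurable_fun [set: T] (fun t => (f t : 'rV[R]_n) ord0 i)) ->
  measurable_fun [set: T] f.
Proof.
move=> mf; apply: (@measurability _ _ T (Rvec R n) setT f (@boxes R n) erefl).
move=> _ [_ [a [b ->]] <-]; rewrite setTI.
rewrite (_ : f @^-1` _ = \bigcap_(i in [set: 'I_n])
   ((fun t => (f t : 'rV[R]_n) ord0 i) @^-1` `]a ord0 i, b ord0 i])).
  apply: fin_bigcap_measurable => // i _.
  by rewrite -[X in measurable X]setTI; exact: mf.
apply/seteqP; split=> [t /= ft i _ /=|t ft i].
  by rewrite in_itv/=; exact: ft.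
by have := ft i I; rewrite /= in_itv.
Qed.

Lemma measurable_affine {R : realType} {n : nat} (m : 'rV[R]_n) (M : 'M[R]_n) :
  measurable_fun [set: Rvec R n] (fun x : Rvec R n => (x - m) *m M : Rvec R n).
Proof.
apply: measurable_fun_rV => i /=.
under [fun _ => _]eq_fun do rewrite mxE.
apply: measurable_sum => j; apply: measurable_funM => //.
under [fun _ => _]eq_fun do rewrite !mxE.
by apply: measurable_funD => //; exact: measurable_coord.
Qed.

Lemma measurable_mahal {R : realType} {n : nat} (m : 'rV[R]_n) (S : 'M[R]_n) :
  measurable_fun [set: Rvec R n] (fun x : Rvec R n => mahal x m S).
Proof.
rewrite /mahal; under [fun _ => _]eq_fun do rewrite mxE.
apply: measurable_sum => j; apply: measurable_funM.
  apply: measurableT_comp (measurable_coord j) _; exact: measurable_affine.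
under [fun _ => _]eq_fun do rewrite !mxE.
by apply: measurable_funD => //; exact: measurable_coord.
Qed.

Lemma measurable_ellipsoid {R : realType} {n : nat} (m : 'rV[R]_n) (S : 'M[R]_n) c :
  measurable (ellipsoid m S c).
Proof.
rewrite (_ : ellipsoid m S c = (fun x : Rvec R n => mahal x m S) @^-1` `]-oo, c ^+ 2[).
  by rewrite -[X in measurable X]setTI; apply: measurable_mahal.
by apply/seteqP; split => x /=; rewrite in_itv.
Qed.

Lemma measurable_MVN {R : realType} {n : nat} (m : 'rV[R]_n) (S : 'M[R]_n) :
  measurable_fun [set: Rvec R n] (fun x : Rvec R n => MVN x m S).
Proof.
apply: measurable_funM => //; apply: measurableT_comp => //.
apply: measurable_funM => //; apply: measurableT_comp => //.
exact: measurable_mahal.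
Qed.

(** * Linear changes of variables *)

(* Cutting [u, v] in halves k times divides the quadratic error by 2^k. *)
Lemma additive_quadratic_error {R : realType} (g : R -> R -> R) (C D : R) :
  (forall u w v, u <= w -> w <= v -> g u v = g u w + g w v) ->
  (forall u v, u <= v -> `|g u v - C * (v - u)| <= D * (v - u) ^+ 2) ->
  forall u v, u <= v -> g u v = C * (v - u).
Proof.
move=> gadd gerr.
have halving k : forall u v, u <= v ->
    `|g u v - C * (v - u)| <= D * (v - u) ^+ 2 / 2 ^+ k.
  elim: k => [|k IH] u v uv; first by rewrite expr0 divr1; exact: gerr.
  pose w := (u + v) / 2.
  have uw : u <= w by rewrite /w; lra.
  have wv : w <= v by rewrite /w; lra.
  rewrite (gadd u w v)// (_ : _ - _ =
    (g u w - C * (w - u)) + (g w v - C * (v - w))); last by ring.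
  apply: le_trans (ler_normD _ _) _.
  apply: le_trans (lerD (IH _ _ uw) (IH _ _ wv)) _.
  rewrite le_eqVlt; apply/orP; left; apply/eqP.
  have p0 : (2 : R) ^+ k != 0 by rewrite expf_neq0.
  by rewrite /w (exprS 2 k); move: (2 ^+ k) p0 => p p0; field.
move=> u v uv; apply/eqP; rewrite -subr_eq0 -normr_le0; apply/ler_addgt0Pl => e e0.
rewrite addr0.
(* After [k] halvings the error is at most [e * x / 2 ^+ k]. Any [k] above [x] brings this below
   [e], because [k < 2 ^ k]. *)
pose x := D * (v - u) ^+ 2 / e.
have x0 : 0 <= x.
  by apply: divr_ge0; [exact: le_trans (gerr _ _ uv)|exact: ltW].
apply: le_trans (halving (Num.bound x) _ _ uv) _.
rewrite ler_pdivrMr ?exprn_gt0// -ler_pdivrMl// mulrC -/x.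
apply: le_trans (ltW (archi_boundP x0)) _.
by rewrite -natrX ler_nat ltnW// ltn_expl.
Qed.

(** Boxes are closed under intersection and generate the sigma-algebra, and the cubes [g k] exhaust
    the space with finite volume. A box with a reversed side is empty, so agreement on ordered
    corners suffices. *)
Lemma lebesgue_unique {R : realType} {n : nat}
    (lam mu : {measure set (Rvec R n) -> \bar R}) :
  is_lebesgue lam ->
  (forall a b : 'rV[R]_n, (forall i, a ord0 i <= b ord0 i) ->
     mu (box a b : set (Rvec R n)) = lam (box a b : set (Rvec R n))) ->
  forall B : set (Rvec R n), measurable B -> mu B = lam B.
Proof.
move=> hlam hmu B mB; apply/esym.
pose g (k : nat) : set (Rvec R n) := box (const_mx (- k.+1%:R)) (const_mx k.+1%:R).
apply: (@measure_unique _ R (Rvec R n) (@boxes R n) g erefl) => //.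
- move=> _ _ [a1 [b1 ->]] [a2 [b2 ->]].
  exists (\row_i Num.max (a1 ord0 i) (a2 ord0 i)), (\row_i Num.min (b1 ord0 i) (b2 ord0 i)).
  apply/seteqP; split=> [x [x1 x2] i|x x12]; last first.
    by split=> i; have := x12 i; rewrite !mxE gt_max le_min; case/andP=> /andP[? ?] /andP[? ?]; exact/andP.
  rewrite !mxE gt_max le_min.
  by case/andP: (x1 i) => -> ->; case/andP: (x2 i) => -> ->.
- by move=> i; eexists; eexists.
- apply/seteqP; split => // x _; have [k xk] := coord_le_bound x.
  exists k => // i; have := xk i; rewrite !mxE ler_norml => /andP[kx xk'].
  have kk : k%:R < k.+1%:R :> R by rewrite ltr_nat.
  by rewrite (le_trans xk' (ltW kk)) andbT (lt_le_trans _ kx)// ltrN2.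
- move=> _ [a [b ->]].
  have [ab|/existsNP[i /negP]] := pselect (forall i, a ord0 i <= b ord0 i).
    by rewrite hmu.
  rewrite -ltNge => ba; rewrite (_ : box a b = set0) ?measure0//.
  apply/seteqP; split=> // x /(_ i) /andP[/lt_le_trans] /[apply].
  by rewrite ltNge (ltW ba).
- move=> k; rewrite hlam ?ltry// => i; rewrite !mxE.
  by rewrite (@le_trans _ _ 0)// ?oppr_le0.
Qed.

(* Satisfied only by invertible [M], since [lam] is nonzero. *)
Definition rescales {R : realType} {n : nat}
    (lam : {measure set (Rvec R n) -> \bar R}) (M : 'M[R]_n) : Prop :=
  forall B : set (Rvec R n), measurable B ->
    (`|\det M|%:E * lam ((fun x : Rvec R n => x *m M : Rvec R n) @^-1` B) = lam B)%E.

Lemma measurable_mulmxr {R : realType} {n : nat} (M : 'M[R]_n) :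
  measurable_fun [set: Rvec R n] (fun x : Rvec R n => x *m M : Rvec R n).
Proof.
rewrite (_ : (fun x => _) = (fun x : Rvec R n => (x - 0) *m M : Rvec R n)).
  exact: measurable_affine.
by apply/funext => x; rewrite subr0.
Qed.


(** The left side is the push-forward of [lam] along [f] scaled by [c]. It is again a measure, so
    uniqueness reduces every change of variables below to boxes. *)
Lemma scaled_preimage_lebesgue {R : realType} {n : nat}
    (lam : {measure set (Rvec R n) -> \bar R}) (f : Rvec R n -> Rvec R n) (c : R) :
  is_lebesgue lam -> 0 <= c -> measurable_fun [set: Rvec R n] f ->
  (forall a b : 'rV[R]_n, (forall i, a ord0 i <= b ord0 i) ->
    (c%:E * lam (f @^-1` (box a b)) = (\prod_i (b ord0 i - a ord0 i))%:E)%E) ->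
  forall B : set (Rvec R n), measurable B -> (c%:E * lam (f @^-1` B) = lam B)%E.
Proof.
move=> hlam c0 mf hf B mB.
have := @lebesgue_unique _ _ lam (mscale (NngNum c0) (pushforward lam f)) hlam.
apply=> // a b ab; rewrite hlam//; exact: hf.
Qed.

Lemma lebesgue_translation {R : realType} {n : nat}
    (lam : {measure set (Rvec R n) -> \bar R}) (m : 'rV[R]_n) :
  is_lebesgue lam -> forall B : set (Rvec R n), measurable B ->
  lam ((fun x : Rvec R n => (x : 'rV[R]_n) - m : Rvec R n) @^-1` B) = lam B.
Proof.
move=> hlam B mB; rewrite -[LHS]mul1e.
apply: scaled_preimage_lebesgue => //.
  rewrite (_ : (fun x => _) = (fun x : Rvec R n => (x - m) *m 1%:M : Rvec R n)).
    exact: measurable_affine.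
  by apply/funext => x; rewrite mulmx1.
move=> a b ab; rewrite mul1e (_ : _ @^-1` _ = box (a + m) (b + m)).
  rewrite hlam; first by congr EFin; apply: eq_bigr => i _; rewrite !mxE; ring.
  by move=> i; rewrite !mxE lerD2r.
by apply/seteqP; split=> x /= xab i; have := xab i; rewrite !mxE ltrBrDr lerBlDr.
Qed.

Lemma rescalesM {R : realType} {n : nat}
    (lam : {measure set (Rvec R n) -> \bar R}) (M N : 'M[R]_n) :
  rescales lam M -> rescales lam N -> rescales lam (M *m N).
Proof.
move=> hM hN B mB.
rewrite det_mulmx normrM mulrC EFinM -muleA -[RHS]hN//; congr (_ * _)%E.
rewrite -[RHS]hM; last first.
  rewrite -[X in measurable X]setTI; exact: measurable_mulmxr.
congr (_ * lam _)%E; apply/seteqP.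
by split => x /=; rewrite mulmxA.
Qed.

Lemma rescales_diag {R : realType} {n : nat}
    (lam : {measure set (Rvec R n) -> \bar R}) (d : 'rV[R]_n) :
  is_lebesgue lam -> (forall i, 0 < d ord0 i) -> rescales lam (diag_mx d).
Proof.
move=> hlam d0; apply: scaled_preimage_lebesgue => //.
  exact: measurable_mulmxr.
move=> a b ab.
rewrite (_ : _ @^-1` _ =
  box (\row_i (a ord0 i / d ord0 i)) (\row_i (b ord0 i / d ord0 i))); last first.
  by apply/seteqP; split=> x /= xab i; have := xab i;
    rewrite mul_mx_diag !mxE ltr_pdivrMr// ler_pdivlMr.
rewrite hlam; last by move=> i; rewrite !mxE ler_pM2r// invr_gt0.
rewrite det_diag -EFinM; congr EFin; rewrite ger0_norm; last first.
  by apply: prodr_ge0 => i _; exact: ltW.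
rewrite -big_split/=; apply: eq_bigr => i _; rewrite !mxE.
by field; rewrite gt_eqF.
Qed.

(** * Transvections preserve volume *)

Definition transvection {R : realType} {n : nat} (i j : 'I_n) (t : R) : 'M[R]_n :=
  1%:M + t *: delta_mx i j.

Lemma mul_transvection {R : realType} {n : nat} (i j : 'I_n) (t : R) (x : 'rV[R]_n) k :
  (x *m transvection i j t) ord0 k = x ord0 k + (k == j)%:R * t * x ord0 i.
Proof.
rewrite mulmxDr mulmx1 mxE; congr (_ + _).
rewrite -scalemxAr !mxE (bigD1 i)//= mxE eqxx big1 ?addr0/=.
  by ring.
by move=> l li; rewrite mxE (negbTE li) mulr0.
Qed.

Lemma det_transvection {R : realType} {n : nat} (i j : 'I_n) (t : R) :
  i != j -> \det (transvection i j t) = 1.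
Proof.
have lower (i' j' : 'I_n) : (j' < i')%N -> \det (transvection i' j' t) = 1.
  move=> ji; rewrite det_trig; last first.
    apply/is_trig_mxP => k l kl; rewrite !mxE.
    rewrite -val_eqE /= (ltn_eqF kl) add0r.
    case: (k =P i') kl => [->|_ _]; last by rewrite mulr0.
    by case: (l =P j') => [->|_ _]; rewrite ?mulr0// ltnNge ltnW.
  apply: big1 => k _; rewrite !mxE eqxx.
  case: (k =P i') => [->|_]; case: eqP => [E|_]; rewrite ?mulr0 ?addr0//.
  by move: ji; rewrite E ltnn.
rewrite neq_ltn => /orP[ij|]; last exact: lower.
rewrite -det_tr -[RHS](lower _ _ ij); congr (\det _).
by apply/matrixP => k l; rewrite !mxE eq_sym andbC.
Qed.

Definition row_set {R : realType} {n : nat} (a : 'rV[R]_n) (j : 'I_n) (u : R) : 'rV[R]_n :=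
  \row_k if k == j then u else a ord0 k.

Lemma row_setE {R : realType} {n : nat} (a : 'rV[R]_n) j u k :
  row_set a j u ord0 k = if k == j then u else a ord0 k.
Proof. exact: mxE. Qed.

Lemma lebesgue_box_row_set {R : realType} {n : nat}
    (lam : {measure set (Rvec R n) -> \bar R}) (a b : 'rV[R]_n) j u v :
  is_lebesgue lam -> (forall i, a ord0 i <= b ord0 i) -> u <= v ->
  lam (box (row_set a j u) (row_set b j v) : set (Rvec R n)) =
  ((v - u) * \prod_(k | k != j) (b ord0 k - a ord0 k))%:E.
Proof.
move=> hlam ab uv; rewrite hlam; last by move=> i; rewrite !mxE; case: eqP.
rewrite (bigD1 j)//= !mxE eqxx; congr (_ * _)%:E.
by apply: eq_bigr => k /negbTE kj; rewrite !mxE kj.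
Qed.

(** The error is quadratic in the width of the box in direction [i], which is the order that
    disappears when the box is cut into slabs across that direction. *)
Lemma shear_box_error {R : realType} {n : nat}
    (lam : {measure set (Rvec R n) -> \bar R}) (i j : 'I_n) (t : R) (a b : 'rV[R]_n) :
  is_lebesgue lam -> i != j -> (forall k, a ord0 k <= b ord0 k) ->
  let P := lam ((fun x : Rvec R n => x *m transvection i j t : Rvec R n) @^-1` box a b) in
  P \is a fin_num /\
  `|fine P - \prod_k (b ord0 k - a ord0 k)| <=
  `|t| * (b ord0 i - a ord0 i) ^+ 2 *
    \prod_(k | (k != j) && (k != i)) (b ord0 k - a ord0 k).
Proof.
move=> hlam ij ab P.
set Q := \prod_(k | _ && _) _.
(* On the box, [t * x_i] stays within [h] of [c]: the sheared box lies between two boxes. *)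
pose c := t * (a ord0 i + b ord0 i) / 2.
pose h := `|t| * (b ord0 i - a ord0 i) / 2.
have h0 : 0 <= h by rewrite /h divr_ge0// mulr_ge0// subr_ge0.
have WQ : \prod_(k | k != j) (b ord0 k - a ord0 k) = (b ord0 i - a ord0 i) * Q.
  by rewrite (bigD1 i).
have W0 : 0 <= \prod_(k | k != j) (b ord0 k - a ord0 k).
  by apply: prodr_ge0 => k _; rewrite subr_ge0.
have abj := ab j.
have tx (x : 'rV[R]_n) : a ord0 i < x ord0 i <= b ord0 i ->
    c - h <= t * x ord0 i <= c + h.
  move=> /andP[xa xb]; rewrite -ler_distl.
  rewrite (_ : _ - c = t * (x ord0 i - (a ord0 i + b ord0 i) / 2)); last first.
    by rewrite /c; field.
  rewrite normrM /h -mulrA ler_wpM2l// ler_norml.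
  by apply/andP; split; lra.
have fE (x : 'rV[R]_n) k : (x *m transvection i j t) ord0 k =
    x ord0 k + (k == j)%:R * t * x ord0 i by exact: mul_transvection.
have mP : measurable ((fun x : Rvec R n => x *m transvection i j t : Rvec R n) @^-1` box a b).
  rewrite -[X in measurable X]setTI; apply: measurable_mulmxr => //.
  exact: measurable_box.
have upper : (P <= ((b ord0 j - c + h - (a ord0 j - c - h)) *
    ((b ord0 i - a ord0 i) * Q))%:E)%E.
  rewrite -WQ -(lebesgue_box_row_set lam a b j)//; last by lra.
  apply: le_measure; rewrite ?inE//; first exact: measurable_box.
  move=> x /= xab k; rewrite !mxE.
  have /tx : a ord0 i < x ord0 i <= b ord0 i.
    by have := xab i; rewrite fE (negbTE ij) !mul0r addr0.
  have := xab k; rewrite fE; case: eqP => [->|_]; last by rewrite !mul0r addr0.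
  by rewrite mul1r => /andP[? ?] /andP[? ?]; apply/andP; split; lra.
have lower : (((b ord0 j - c - h - (a ord0 j - c + h)) *
    ((b ord0 i - a ord0 i) * Q))%:E <= P)%E.
  (* If the shear displaces more than the side [j] allows, the inner box has reversed ends; the
     claimed lower bound is then nonpositive and holds trivially. *)
  have [ov|vo] := leP (a ord0 j - c + h) (b ord0 j - c - h); last first.
    by apply: le_trans (measure_ge0 _ _); rewrite lee_fin -WQ mulr_le0_ge0//; lra.
  rewrite -WQ -(lebesgue_box_row_set lam a b j)//.
  apply: le_measure; rewrite ?inE//; first exact: measurable_box.
  move=> x /= xab k; rewrite fE.
  have /tx : a ord0 i < x ord0 i <= b ord0 i by have := xab i; rewrite !mxE (negbTE ij).
  have := xab k; rewrite !mxE; case: eqP => [->|_]; last by rewrite !mul0r addr0.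
  by rewrite mul1r => /andP[? ?] /andP[? ?]; apply/andP; split; lra.
have Pfin : P \is a fin_num.
  by rewrite ge0_fin_numE ?measure_ge0// (le_lt_trans upper) ?ltry.
split => //.
move: upper lower; rewrite -(fineK Pfin) !lee_fin /= => upper lower.
rewrite (bigD1 j)//= WQ ler_norml.
have -> : `|t| * (b ord0 i - a ord0 i) ^+ 2 * Q = 2 * h * ((b ord0 i - a ord0 i) * Q).
  by rewrite /h; field.
apply/andP; split.
  by rewrite lerBrDr; apply: le_trans lower; rewrite le_eqVlt; apply/orP; left; apply/eqP; ring.
by rewrite lerBlDr; apply: le_trans upper _; rewrite le_eqVlt; apply/orP; left; apply/eqP; ring.
Qed.

(** Coordinate [i] is fixed by the shear, so the sheared volume of a slab across direction [i] is
    additive in its ends. It differs from [C * (v - u)] by at most [D * (v - u) ^+ 2], hence not at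
    all. *)
Lemma rescales_transvection {R : realType} {n : nat}
    (lam : {measure set (Rvec R n) -> \bar R}) (i j : 'I_n) (t : R) :
  is_lebesgue lam -> i != j -> rescales lam (transvection i j t).
Proof.
move=> hlam ij; apply: scaled_preimage_lebesgue => //.
  exact: measurable_mulmxr.
move=> a b ab; rewrite det_transvection// normr1 mul1e.
pose f (x : Rvec R n) : Rvec R n := x *m transvection i j t.
pose slab u v : set (Rvec R n) := f @^-1` box (row_set a i u) (row_set b i v).
have mslab u v : measurable (slab u v).
  rewrite -[X in measurable X]setTI; apply: measurable_mulmxr => //.
  exact: measurable_box.
have ab_slab u v k : u <= v -> row_set a i u ord0 k <= row_set b i v ord0 k.
  by move=> uv; rewrite !mxE; case: eqP.
pose C := \prod_(k | k != i) (b ord0 k - a ord0 k).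
pose D := `|t| * \prod_(k | (k != j) && (k != i)) (b ord0 k - a ord0 k).
have fin_slab u v : u <= v -> lam (slab u v) \is a fin_num.
  by move=> uv; have [] := shear_box_error lam i j t _ _ hlam ij (fun k => ab_slab u v k uv).
pose g u v := fine (lam (slab u v)).
suff gE : g (a ord0 i) (b ord0 i) = C * (b ord0 i - a ord0 i).
  have slabE : slab (a ord0 i) (b ord0 i) = f @^-1` box a b.
    by congr (f @^-1` box _ _); apply/rowP => k; rewrite !mxE; case: eqP => [->|].
  rewrite -slabE -[LHS]fineK ?fin_slab// -/(g _ _) gE; congr EFin.
  by rewrite [RHS](bigD1 i)//= mulrC.
(* [g u v] is the sheared volume of the slab [u < x_i <= v]. *)
apply: (@additive_quadratic_error _ g C D) => //.
- move=> u w v uw wv; rewrite /g.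
  have uv := le_trans uw wv.
  rewrite -fineD ?fin_slab// -measureU//; last first.
    apply/seteqP; split=> // x [/= xl xr].
    have := xl i; have := xr i; rewrite !mxE eqxx => /andP[+ _] /andP[_ +].
    by move=> /lt_le_trans/[apply]; rewrite ltxx.
  congr (fine (lam _)); apply/seteqP; split=> [x xs|x [] xs k].
  + have [xw|wx] := leP (f x ord0 i) w; [left|right] => k; have := xs k;
      rewrite !row_setE; case: eqP => [->|//] /andP[? ?]; apply/andP; split=> //.
  + have := xs k; rewrite !row_setE; case: eqP => [->|//] /andP[-> xw] /=.
    exact: le_trans wv.
  + have := xs k; rewrite !row_setE; case: eqP => [->|//] /andP[wx ->]; rewrite andbT.
    exact: le_lt_trans wx.
- move=> u v uv.
  have [_] := shear_box_error lam i j t _ _ hlam ij (fun k => ab_slab u v k uv).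
  rewrite -/(slab u v) -/(g u v) (bigD1 i)//= !row_setE eqxx.
  rewrite (eq_bigr (fun k => b ord0 k - a ord0 k)); last first.
    by move=> k /negbTE ki; rewrite !row_setE ki.
  rewrite -/C mulrC.
  rewrite [X in _ <= _ * X](eq_bigr (fun k => b ord0 k - a ord0 k)); last first.
    by move=> k /andP[_ /negbTE ki]; rewrite !row_setE ki.
  by rewrite /D mulrAC.
Qed.

(* The Cholesky algorithm, keeping track of the elementary matrices it multiplies. *)
Lemma posdef_congruent_1 {R : realType} {n : nat} (G : 'M[R]_n -> Prop) (S : 'M[R]_n) :
  (forall M N, G M -> G N -> G (M *m N)) ->
  (forall d : 'rV[R]_n, (forall i, 0 < d ord0 i) -> G (diag_mx d)) ->
  (forall i j t, i != j -> G (transvection i j t)) ->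
  posdef S -> exists2 M, G M & M *m S *m M^T = 1%:M.
Proof.
elim: n G S => [|n IH] G S.
  move=> _ Gd _ _; exists (diag_mx 0); first by apply: Gd => -[].
  by apply/matrixP => -[].
rewrite -[n.+1]/(1 + n)%N in G S *.
move=> GM Gd Gt [Ssym Spos].
pose r : 'rV[R]_n := ursubmx S; pose q : R := S 0 0.
have SE : S = block_mx q%:M r r^T (drsubmx S).
  rewrite -[LHS]submxK; congr block_mx.
    by rewrite [LHS]mx11_scalar !mxE; congr (S _ _)%:M; apply: val_inj.
  by rewrite /r -[in RHS]Ssym -trmx_dlsub trmxK.
have q0 : 0 < q.
  have := Spos (delta_mx 0 0).
  rewrite -rowE trmx_delta -colE !mxE; apply.
  by apply/eqP => /matrixP/(_ 0 0)/eqP; rewrite !mxE !eqxx oner_eq0.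
(* One step of symmetric elimination: [E] clears the first column below the pivot [q], [E^T] clears
   the first row, and [Q1] is the Schur complement of [q]. *)
pose v : 'cV[R]_n := - q^-1 *: r^T.
pose E : 'M[R]_(1 + n) := block_mx 1%:M 0 v 1%:M.
pose Q1 := v *m r + drsubmx S.
have vT : v^T = - q^-1 *: r by rewrite /v linearZ/= trmxK.
have ESE : E *m S *m E^T = block_mx q%:M 0 0 Q1.
  rewrite SE /E mulmx_block tr_block_mx mulmx_block !trmx0 !trmx1 !mul1mx !mul0mx.
  rewrite !mulmx1 !mulmx0 !addr0 ?add0r vT mul_mx_scalar ?mul_scalar_mx.
  rewrite /v !scalerA mulrN divff ?gt_eqF// !scaleN1r !addNr mul0mx add0r.
  by congr block_mx; rewrite /Q1 -/v.
have GE : G E.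
  (* Adding columns [w] corresponds to multiplying these block matrices, so splitting [w] into
     single entries factors the matrix into transvections. The empty product is the identity, which
     is diagonal. *)
  have GX (w : 'cV[R]_n) : G (block_mx 1%:M 0 w 1%:M).
    rewrite (matrix_sum_delta w).
    under eq_bigr do rewrite big_ord1.
    elim: (index_enum _) => [|k s IHs].
      rewrite big_nil -scalar_mx_block -diag_const_mx; apply: Gd => i.
      by rewrite mxE.
    rewrite big_cons.
    have -> (x y : 'cV[R]_n) : block_mx 1%:M 0 (x + y) 1%:M =
        block_mx 1%:M 0 x 1%:M *m block_mx 1%:M 0 y 1%:M :> 'M[R]_(1 + n).
      rewrite mulmx_block !mul1mx !mul0mx !mulmx1 !mulmx0 !addr0 !add0r.
      by [].
    apply: GM => //.
    have := Gt (rshift 1 k) (lshift n 0) (w k 0) isT; congr G.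
    apply/matrixP => i j; rewrite !mxE.
    case: split_ordP => i' ->; rewrite !mxE; case: split_ordP => j' ->; rewrite !mxE.
    - by rewrite !eq_lshift !ord1 !eqxx /= mulr0 addr0.
    - by rewrite !eq_lrshift /= mulr0 addr0.
    - by rewrite !eq_rlshift !eq_rshift !ord1 eqxx andbT add0r.
    - by rewrite !eq_rlshift !eq_rshift andbF mulr0 addr0.
  exact: GX.
have Q1pos : posdef Q1.
  split.
    have : (E *m S *m E^T)^T = E *m S *m E^T.
      by rewrite !trmx_mul trmxK Ssym mulmxA.
    by rewrite ESE tr_block_mx => /eq_block_mx[].
  move=> x x0.
  (* The form of [Q1] at [x] is the form of [S] at this vector, which is nonzero because its last
     [n] coordinates are [x]. *)
  have := Spos (row_mx 0 x *m E).
  rewrite trmx_mul !mulmxA -(mulmxA _ E) -(mulmxA _ _ E^T) ESE.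
  rewrite !mul_row_block tr_row_mx ?mul0mx ?add0r mul_row_col ?mul0mx.
  rewrite ?trmx0 ?mulmx0 ?add0r mulmx1; apply.
  by rewrite row_mx_eq0 negb_and x0 orbT.
pose D (M : 'M[R]_n) : 'M[R]_(1 + n) := block_mx 1%:M 0 0 M.
have DM M N : D (M *m N) = D M *m D N.
  by rewrite /D mulmx_block !mul1mx ?mul0mx ?mulmx0 ?addr0 ?add0r.
(* The induction runs with the predicate [G \o D]: the embedding [D] into the lower right corner
   sends diagonal matrices and transvections to matrices of the same kind. *)
have [|||M1 GM1 M1Q1] := IH (G \o D) Q1 _ _ _ Q1pos.
- by move=> M N /= hM hN; rewrite DM; exact: GM.
- move=> d d0 /=; rewrite (_ : D _ = diag_mx (row_mx (const_mx 1) d)); last first.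
    by rewrite diag_mx_row diag_const_mx.
  apply: Gd => i; rewrite mxE; case: splitP => j _ //.
  by rewrite mxE.
- move=> i j t ij /=; rewrite (_ : D _ = transvection (rshift 1 i) (rshift 1 j) t).
    by apply: Gt; rewrite eq_rshift.
  apply/matrixP => k l; rewrite !mxE.
  case: split_ordP => k' ->; rewrite !mxE; case: split_ordP => l' ->; rewrite !mxE.
  + by rewrite eq_lshift eq_lrshift /= mulr0 addr0.
  + by rewrite !eq_lrshift /= mulr0 addr0.
  + by rewrite !eq_rlshift eq_lrshift andbF mulr0 addr0.
  + by rewrite !eq_rshift.
(* The last factor [F] normalises the pivot, since [s * q * s = 1]. *)
pose s : R := (Num.sqrt q)^-1.
pose F : 'M[R]_(1 + n) := block_mx s%:M 0 0 1%:M.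
have s0 : 0 < s by rewrite invr_gt0 sqrtr_gt0.
have GF : G F.
  rewrite (_ : F = diag_mx (row_mx (const_mx s) (const_mx 1))); last first.
    by rewrite diag_mx_row !diag_const_mx.
  by apply: Gd => i; rewrite mxE; case: splitP => j _; rewrite mxE.
exists (F *m (D M1 *m E)); first by apply: (GM) => //; exact: GM.
rewrite !trmx_mul !mulmxA -(mulmxA _ E) -(mulmxA _ _ E^T) ESE.
rewrite -(mulmxA _ (D M1)) -(mulmxA _ _ (D M1)^T).
have -> : D M1 *m block_mx q%:M 0 0 Q1 *m (D M1)^T = block_mx q%:M 0 0 1%:M.
  rewrite /D tr_block_mx !mulmx_block !trmx0 !trmx1 !mul1mx ?mul0mx ?mulmx0 ?mul0mx.
  by rewrite !mulmx1 ?addr0 ?add0r M1Q1 mul0mx.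
rewrite /F tr_block_mx !mulmx_block !trmx0 !trmx1 !mul1mx ?mul0mx ?mulmx0 ?mul0mx.
rewrite ?mulmx1 ?addr0 ?add0r tr_scalar_mx -?scalar_mxM ?mul0mx.
have -> : s * q * s = 1.
  by rewrite mulrAC /s -invfM -expr2 sqr_sqrtr ?ltW// mulVf// gt_eqF.
by rewrite -scalar_mx_block.
Qed.

(** If [M *m S *m M^T = 1%:M], then [invmx S = M^T *m M], so [N := M^T] turns the Mahalanobis form
    into a sum of squares. Vectors are rows and matrices act on the right, which is why the
    rescaling property is carried along for [M^T]. *)
Lemma posdef_whitening {R : realType} {n : nat}
    (lam : {measure set (Rvec R n) -> \bar R}) (S : 'M[R]_n) :
  is_lebesgue lam -> posdef S ->
  exists N : 'M[R]_n, [/\ rescales lam N, 0 < \det S, `|\det N|^-1 = Num.sqrt (\det S) &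
    forall x m : 'rV[R]_n, mahal x m S = mahal ((x - m) *m N) 0 1%:M].
Proof.
move=> hlam posS.
have [||i j t ij||M hM MSM] := posdef_congruent_1 (fun M => rescales lam M^T) S.
- by move=> M N hM hN; rewrite trmx_mul; exact: rescalesM.
- by move=> d d0; rewrite tr_diag_mx; exact: rescales_diag.
- rewrite (_ : _^T = transvection j i t).
    by apply: rescales_transvection; rewrite // eq_sym.
  by apply/matrixP => k l; rewrite !mxE eq_sym andbC.
- exact: posS.
have detM : \det M ^+ 2 * \det S = 1.
  by rewrite -[RHS](det1 _ n) -MSM !det_mulmx det_tr expr2 mulrAC.
have M0 : \det M != 0.
  by apply: contra_eqN detM => /eqP ->; rewrite expr0n/= mul0r eq_sym oner_neq0.
have detS : \det S = (\det M ^+ 2)^-1.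
  by apply: (@mulfI _ (\det M ^+ 2)); rewrite ?expf_neq0// detM divff// expf_neq0.
have S0 : 0 < \det S by rewrite detS invr_gt0 exprn_even_gt0.
exists M^T; split => //.
- by rewrite det_tr detS sqrtrV ?sqr_ge0// sqrtr_sqr.
- move=> x m; rewrite /mahal subr0 invmx1 mulmx1 trmx_mul trmxK.
  have SU : S \in unitmx by rewrite unitmxE unitfE gt_eqF.
  rewrite (_ : invmx S = M^T *m M) ?mulmxA//.
  by rewrite -[RHS](mulKmx SU) (mulmxA S) (mulmx1C (_ : M *m (S *m M^T) = 1%:M)) ?mulmx1// mulmxA.
Qed.

(** * Ellipsoids *)

(** The common part of [A] and [E] contributes equally to both integrals. The remainders [E \ A] and
    [A \ E] have equal measure, and [g] is at most [tau] on the first and at least [tau] on the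
    second. *)
Lemma bathtub {d} {T : measurableType d} {R : realType}
    (mu : {measure set T -> \bar R}) (A E : set T) (g : T -> \bar R) (tau : \bar R) :
  measurable A -> measurable E -> mu A = mu E -> (mu E < +oo)%E ->
  measurable_fun [set: T] g -> (forall x, 0 <= g x)%E -> (0 <= tau)%E ->
  (forall x, E x -> g x <= tau)%E -> (forall x, ~ E x -> tau <= g x)%E ->
  (\int[mu]_(x in E) g x <= \int[mu]_(x in A) g x)%E.
Proof.
move=> mA mE AE Efin mg g0 tau0 gE gnE.
have split (B C : set T) : measurable B -> measurable C ->
    (\int[mu]_(x in B) g x =
     \int[mu]_(x in B `&` C) g x + \int[mu]_(x in B `\` C) g x)%E.
  move=> mB mC; rewrite -[in LHS](setUIDK B C) ge0_integral_setU//.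
  - exact: measurableI.
  - exact: measurableD.
  - exact: measurable_funTS.
  - by rewrite disj_set2E; apply/eqP/seteqP; split=> // x [[_ Cx] [_ /(_ Cx)]].
rewrite (split E A)// (split A E)// (setIC E A); apply: leeD => //.
have EDA : mu (E `\` A) = mu (A `\` E).
  have Afin : (mu A < +oo)%E by rewrite AE.
  by rewrite !measureD// (setIC E); congr (_ - _)%E.
apply: (@le_trans _ _ (tau * mu (E `\` A))%E).
  rewrite -integral_cst; last exact: measurableD.
  apply: ge0_le_integral => //.
  - exact: measurableD.
  - exact: measurable_funTS.
  - by move=> x [Ex _]; exact: gE.
rewrite EDA -integral_cst; last exact: measurableD.
apply: ge0_le_integral => //.
- exact: measurableD.
- exact: measurable_funTS.
- by move=> x [_ nEx]; exact: gnE.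
Qed.

(** Centring at [m] preserves volume and the linear part scales it, so from here on only these
    properties of the affine map are used. *)
Lemma whitening_map {R : realType} {n : nat}
    (lam : {measure set (Rvec R n) -> \bar R}) (m : 'rV[R]_n) (S : 'M[R]_n) :
  is_lebesgue lam -> posdef S ->
  0 < \det S /\
  exists phi : Rvec R n -> Rvec R n, [/\ measurable_fun [set: Rvec R n] phi,
    forall B, measurable B -> lam (phi @^-1` B) = ((Num.sqrt (\det S))%:E * lam B)%E &
    forall x, mahal x m S = mahal (phi x) 0 1%:M].
Proof.
move=> hlam posS; have [N [rN detS sN mN]] := posdef_whitening lam S hlam posS.
split => //; exists (fun x => (x - m) *m N); split => [|B mB|x]; last exact: mN.
  exact: measurable_affine.
have N0 : `|\det N| != 0.
  by apply: contraTneq (detS) => N0; move: sN; rewrite N0 invr0 => /esym/eqP;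
    rewrite sqrtr_eq0 leNgt.
rewrite -sN -(rN B)// muleA -EFinM mulVf// mul1e -[RHS](lebesgue_translation lam m)//.
rewrite -[X in measurable X]setTI; exact: measurable_mulmxr.
Qed.

Lemma mahal0 {R : realType} {n : nat} (x : 'rV[R]_n) :
  mahal x 0 1%:M = \sum_i x ord0 i ^+ 2.
Proof.
rewrite /mahal subr0 invmx1 mulmx1 mxE; apply: eq_bigr => i _.
by rewrite mxE expr2.
Qed.

Lemma ball_volume_fin {R : realType} {n : nat}
    (lam : {measure set (Rvec R n) -> \bar R}) (c : R) :
  is_lebesgue lam -> 0 < c -> (lam (ellipsoid 0 1%:M c) < +oo)%E.
Proof.
move=> hlam c0.
apply: (@le_lt_trans _ _ (lam (box (const_mx (- c)) (const_mx c) : set (Rvec R n)))).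
  apply: le_measure; rewrite ?inE; [exact: measurable_ellipsoid|exact: measurable_box|].
  move=> x; rewrite /ellipsoid /= mahal0 => xc i; rewrite !mxE.
  suff : `|x ord0 i| < c by rewrite ltr_norml => /andP[-> /ltW].
  rewrite -(@ltr_pXn2r _ 2) ?nnegrE// ?ltW// real_normK ?num_real//.
  apply: le_lt_trans xc; rewrite (bigD1 i)//= lerDl sumr_ge0// => j _.
  exact: sqr_ge0.
rewrite hlam ?ltry// => i; rewrite !mxE; lra.
Qed.

Lemma ball_volume_gt0 {R : realType} {n : nat}
    (lam : {measure set (Rvec R n) -> \bar R}) (c : R) :
  is_lebesgue lam -> 0 < c -> (0 < lam (ellipsoid 0 1%:M c))%E.
Proof.
(* A cube of side [e] fits into the ball since [n * e ^+ 2 < (n.+1 * e) ^+ 2 = c ^+ 2]; the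
   successor also covers dimension 0. *)
move=> hlam c0; pose e := c / n.+1%:R.
have e0 : 0 < e by rewrite divr_gt0.
apply: (@lt_le_trans _ _ (lam (box 0 (const_mx e) : set (Rvec R n)))).
  rewrite hlam ?lte_fin; last by move=> i; rewrite !mxE ltW.
  by apply: prodr_gt0 => i _; rewrite !mxE subr0.
apply: le_measure; rewrite ?inE; [exact: measurable_box|exact: measurable_ellipsoid|].
move=> x /= xe; rewrite /ellipsoid /= mahal0.
apply: (@le_lt_trans _ _ (\sum_(i < n) e ^+ 2)).
  apply: ler_sum => i _; have := xe i; rewrite !mxE => /andP[x0 xe'].
  by rewrite ler_pXn2r// nnegrE ltW.
rewrite sumr_const card_ord -mulr_natr.
have -> : c = e * n.+1%:R by rewrite /e divfK.
rewrite [X in _ < X]exprMn ltr_pM2l ?exprn_gt0// -natrX ltr_nat.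
by rewrite (@leq_trans (n.+1 ^ 1))// leq_pexp2l.
Qed.

Lemma ball_volume_scale {R : realType} {n : nat}
    (lam : {measure set (Rvec R n) -> \bar R}) (c : R) :
  is_lebesgue lam -> 0 < c ->
  lam (ellipsoid 0 1%:M c) = ((c ^+ n)%:E * lam (ellipsoid 0 1%:M 1))%E.
Proof.
move=> hlam c0.
have c'0 : 0 < c^-1 by rewrite invr_gt0.
have := rescales_diag lam (const_mx c^-1) hlam.
move=> /(_ (fun i => _)) H.
have {}H : rescales lam (diag_mx (const_mx c^-1)) by apply: H => i; rewrite mxE.
rewrite -(H (ellipsoid 0 1%:M 1)); last exact: measurable_ellipsoid.
rewrite diag_const_mx det_scalar ger0_norm ?exprn_ge0 ?ltW//.
rewrite muleA -EFinM -exprMn divff ?gt_eqF// expr1n mul1e; congr (lam _).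
have normZ (x : 'rV[R]_n) : mahal (x *m c^-1%:M) 0 1%:M = mahal x 0 1%:M / c ^+ 2.
  rewrite !mahal0 mul_mx_scalar mulr_suml; apply: eq_bigr => i _.
  by rewrite mxE exprMn exprVn mulrC.
by apply/seteqP; rewrite /ellipsoid; split => x /=;
  rewrite normZ expr1n ltr_pdivrMr ?exprn_gt0// mul1r.
Qed.

(** Whitening pulls the ellipsoid back to a ball, so [v] is the unit ball volume times the square
    root of [\det S]. The explicit power of [c] allows solving for the radius that gives a
    prescribed volume. *)
Lemma ellipsoid_volume {R : realType} {n : nat}
    (lam : {measure set (Rvec R n) -> \bar R}) (m : 'rV[R]_n) (S : 'M[R]_n) :
  is_lebesgue lam -> posdef S ->
  exists2 v : R, 0 < v & forall c, 0 < c -> lam (ellipsoid m S c) = (v * c ^+ n)%:E.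
Proof.
move=> hlam posS; have [S0 [phi [mphi phiE mahalE]]] := whitening_map lam m S hlam posS.
have B0 := ball_volume_gt0 lam 1 hlam ltr01.
have Bfin := ball_volume_fin lam 1 hlam ltr01.
exists (Num.sqrt (\det S) * fine (lam (ellipsoid 0 1%:M 1))) => [|c c0].
  by rewrite mulr_gt0 ?sqrtr_gt0// fine_gt0// B0.
rewrite (_ : ellipsoid m S c = phi @^-1` ellipsoid 0 1%:M c); last first.
  by apply/seteqP; split => x /=; rewrite /ellipsoid /= mahalE.
rewrite phiE; last exact: measurable_ellipsoid.
rewrite ball_volume_scale// mulrAC EFinM fineK ?ge0_fin_numE// EFinM muleA.
by [].
Qed.

(** The integral attached to one component in [Ubound]; for a centred ball and the standard normal
    it is [cR_objective]. *)
Definition inv_density_ratio {R : realType} {n : nat}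
    (lam : {measure set (Rvec R n) -> \bar R}) (m : 'rV[R]_n) (S : 'M[R]_n)
    (A : set (Rvec R n)) : \bar R :=
  (\int[lam]_(x in A) ((fine (lam A))^-2 / MVN x m S)%:E)%E.

Lemma MVN_inv {R : realType} {n : nat} (x m : 'rV[R]_n) (S : 'M[R]_n) :
  (MVN x m S)^-1 = Num.sqrt ((2 * pi) ^+ n * \det S) * expR (mahal x m S / 2).
Proof. by rewrite /MVN invfM invrK mulNr expRN invrK. Qed.

Lemma measurable_MVN_inv {R : realType} {n : nat} (m : 'rV[R]_n) (S : 'M[R]_n) :
  measurable_fun [set: Rvec R n] (fun x : Rvec R n => (MVN x m S)^-1).
Proof.
under [fun _ => _]eq_fun do rewrite MVN_inv.
apply: measurable_funM => //; apply: measurableT_comp => //.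
by apply: measurable_funM => //; exact: measurable_mahal.
Qed.

Lemma MVN_ge0 {R : realType} {n : nat} (x m : 'rV[R]_n) (S : 'M[R]_n) : 0 <= MVN x m S.
Proof. by rewrite /MVN mulr_ge0 ?expR_ge0// invr_ge0. Qed.

(** The value does not depend on [m] and [S]: with [s] the square root of [\det S], the squared
    volume contributes [s ^- 2], the normalising constant of the density [s], and the change of
    variables another [s]. *)
Lemma inv_density_ratio_ellipsoid {R : realType} {n : nat}
    (lam : {measure set (Rvec R n) -> \bar R}) (m : 'rV[R]_n) (S : 'M[R]_n) (c : R) :
  is_lebesgue lam -> posdef S -> 0 < c ->
  inv_density_ratio lam m S (ellipsoid m S c) = cR_objective lam c.
Proof.
move=> hlam posS c0; have [S0 [phi [mphi phiE mahalE]]] := whitening_map lam m S hlam posS.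
rewrite /inv_density_ratio /cR_objective.
have -> : ellipsoid m S c = phi @^-1` ellipsoid 0 1%:M c.
  by apply/seteqP; split => x /=; rewrite /ellipsoid /= mahalE.
set B := ellipsoid 0 1%:M c.
have mB : measurable B by exact: measurable_ellipsoid.
set s := Num.sqrt (\det S) in phiE *.
have s0 : 0 < s by rewrite sqrtr_gt0.
have vB : fine (lam (phi @^-1` B)) = s * fine (lam B).
  rewrite phiE// fineM// ge0_fin_numE//; exact: ball_volume_fin.
rewrite vB; set v := fine (lam B).
pose g (y : Rvec R n) : \bar R := ((s * v) ^- 2 * s / MVN y 0 1%:M)%:E.
have mg : measurable_fun [set: Rvec R n] g.
  apply/measurable_EFinP; apply: measurable_funM => //; exact: measurable_MVN_inv.
have g0 y : (0 <= g y)%E.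
  by rewrite lee_fin divr_ge0 ?MVN_ge0// mulr_ge0 ?(ltW s0)// invr_ge0 sqr_ge0.
transitivity (\int[lam]_(x in phi @^-1` B) (g \o phi) x)%E.
  apply: eq_integral => x _ /=; rewrite /g -[RHS]/(_ %:E); congr EFin.
  rewrite -!mulrA; congr (_ * _); rewrite !MVN_inv det1 mulr1 -mahalE mulrA; congr (_ * _).
  by rewrite Num.Theory.sqrtrM ?exprn_ge0 ?mulr_ge0 ?pi_ge0// mulrC.
rewrite -ge0_integral_pushforward//; last exact: measurable_funTS.
rewrite (eq_measure_integral (mscale (NngNum (ltW s0)) lam)); last first.
  by move=> A mA _; exact: phiE.
rewrite ge0_integral_mscale//; last exact: measurable_funTS.
rewrite -ge0_integralZl_EFin//=; last 2 first.
- exact: measurable_funTS.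
- exact: ltW.
apply: eq_integral => x _; rewrite /g -EFinM; congr EFin.
rewrite !mulrA; congr (_ / _); rewrite exprMn invfM; move: (v ^+ 2)^-1 => w.
by field; rewrite gt_eqF.
Qed.

Lemma inv_density_ratio_min {R : realType} {n : nat}
    (lam : {measure set (Rvec R n) -> \bar R}) (m : 'rV[R]_n) (S : 'M[R]_n) (c0 : R)
    (A : set (Rvec R n)) :
  (0 < n)%N -> is_lebesgue lam -> posdef S ->
  (forall c : R, 0 < c -> (cR_objective lam c0 <= cR_objective lam c)%E) ->
  measurable A -> (0 < lam A)%E -> (lam A < +oo)%E ->
  (cR_objective lam c0 <= inv_density_ratio lam m S A)%E.
Proof.
move=> n0 hlam posS c0min mA A0 Afin.
have [v v0 vE] := ellipsoid_volume lam m S hlam posS.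
have lamA : lam A = (fine (lam A))%:E by rewrite fineK// ge0_fin_numE.
have fA0 : 0 < fine (lam A) by rewrite fine_gt0// A0.
(* The radius solves [v * c ^+ n = lam A]. With equal volumes the two integrals have the same
   integrand, as the bathtub principle requires. *)
pose c := (fine (lam A) / v) `^ n%:R^-1.
have c_gt0 : 0 < c by rewrite powR_gt0// divr_gt0.
have AE : lam A = lam (ellipsoid m S c).
  rewrite vE// lamA -powR_mulrn ?ltW// -powRrM mulVf ?pnatr_eq0 -?lt0n//.
  by rewrite powRr1 ?divr_ge0 ?ltW// mulrC divfK ?gt_eqF.
apply: le_trans (c0min c c_gt0) _.
rewrite -(inv_density_ratio_ellipsoid lam m S c hlam posS c_gt0) /inv_density_ratio AE.
(* The threshold is the value of the integrand on the boundary of the ellipsoid, where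
   [mahal x m S = c ^+ 2]. *)
pose tau : R := (fine (lam (ellipsoid m S c)))^-2 *
  (Num.sqrt ((2 * pi) ^+ n * \det S) * expR (c ^+ 2 / 2)).
apply: (bathtub lam A _ _ tau%:E) => //.
- exact: measurable_ellipsoid.
- by rewrite -AE.
- by apply/measurable_EFinP; apply: measurable_funM => //; exact: measurable_MVN_inv.
- by move=> x; rewrite lee_fin divr_ge0 ?MVN_ge0// invr_ge0 sqr_ge0.
- by rewrite lee_fin !mulr_ge0 ?expR_ge0 ?invr_ge0 ?sqr_ge0.
- move=> x Ex; rewrite lee_fin /tau MVN_inv ler_wpM2l ?invr_ge0 ?sqr_ge0//.
  by rewrite ler_wpM2l// ler_expR ler_pM2r// ltW.
- move=> x /negP; rewrite -leNgt => Ex.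
  rewrite lee_fin /tau MVN_inv ler_wpM2l ?invr_ge0 ?sqr_ge0//.
  by rewrite ler_wpM2l// ler_expR ler_pM2r.
Qed.

(** Cauchy-Schwarz in quotient form. With [B] and [Q] the two sums, dividing by [Q] leaves as
    difference the weighted sum of the squares [(b i / q i - B / Q) ^+ 2]. The case [Q = 0] occurs
    only for an empty index type. *)
Lemma sum_sqr_le {R : realType} {I : finType} (b q : I -> R) :
  (forall i, 0 < q i) ->
  (\sum_i b i) ^+ 2 <= (\sum_i b i ^+ 2 / q i) * \sum_i q i.
Proof.
move=> q0.
have [Q0|Q0] := eqVneq (\sum_i q i) 0.
  suff -> : \sum_i b i = 0 by rewrite Q0 mulr0 expr0n.
  apply: big1 => i _.
  have := q0 i; have /eqP := Q0; rewrite psumr_eq0; last by move=> k _; exact: ltW.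
  by move=> /allP/(_ i (mem_index_enum i))/= /eqP ->; rewrite ltxx.
have Qpos : 0 < \sum_i q i by rewrite lt_def Q0 sumr_ge0// => i _; exact: ltW.
set B := \sum_i b i; set Q := \sum_i q i in Q0 Qpos *.
rewrite -ler_pdivrMr// -subr_ge0.
have -> : (\sum_i b i ^+ 2 / q i) - B ^+ 2 / Q = \sum_i q i * (b i / q i - B / Q) ^+ 2.
  transitivity (\sum_i (b i ^+ 2 / q i - 2 * (B / Q) * b i + (B / Q) ^+ 2 * q i)).
    by rewrite big_split/= big_split/= sumrN -!mulr_sumr -/B -/Q; field.
  by apply: eq_bigr => i _; field; rewrite Q0 gt_eqF.
by apply: sumr_ge0 => i _; rewrite mulr_ge0 ?sqr_ge0// ltW.
Qed.

(** * Moments of the estimator *)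

Section density.
Import HBNNSimple.

(** The hypothesis on [nu] is the case of indicators. Linearity extends it to the simple functions
    [h n], and monotone convergence on both sides to [f]. *)
Lemma ge0_integral_density {d} {T : measurableType d} {R : realType}
    (mu nu : {measure set T -> \bar R}) (p : T -> R) (f : T -> \bar R) :
  measurable_fun [set: T] p -> (forall x, 0 <= p x) ->
  (forall B, measurable B -> nu B = \int[mu]_(x in B) (p x)%:E)%E ->
  measurable_fun [set: T] f -> (forall x, 0 <= f x)%E ->
  (\int[nu]_x f x = \int[mu]_x (f x * (p x)%:E))%E.
Proof.
move=> mp p0 nuE mf f0.
pose h := nnsfun_approx measurableT mf.
have mpE : measurable_fun [set: T] (EFin \o p) by exact/measurable_EFinP.
have hf x : (EFin \o h ^~ x) n @[n --> \oo] --> f x.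
  by apply: cvg_nnsfun_approx.
transitivity (limn (fun n => \int[nu]_x (EFin \o h n) x)%E).
  rewrite -monotone_convergence//.
  - by apply: eq_integral => x _; apply/esym/cvg_lim => //; exact: hf.
  - by move=> n; exact/measurable_EFinP/measurable_funP.
  - by move=> n x _; rewrite lee_fin.
  - by move=> x _ a b ab; rewrite lee_fin; exact/lefP/nd_nnsfun_approx.
transitivity (limn (fun n => \int[mu]_x ((EFin \o h n) x * (p x)%:E))%E); last first.
  rewrite -monotone_convergence//.
  - apply: eq_integral => x _; apply/cvg_lim => //; apply: cvgeZr => //.
    exact: hf.
  - by move=> n; apply: emeasurable_funM => //; exact/measurable_EFinP/measurable_funP.
  - by move=> n x _; rewrite mule_ge0 ?lee_fin.
  - by move=> x _ a b ab; rewrite lee_wpmul2r ?lee_fin//; exact/lefP/nd_nnsfun_approx.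
congr (limn _); apply/funext => n.
have indicp r x : ((\1_(h n @^-1` [set r]) x)%:E * (p x)%:E =
    ((EFin \o p) \_ (h n @^-1` [set r])) x)%E.
  by rewrite epatch_indic muleC.
transitivity (\int[nu]_x (\sum_(y \in range (h n))
    (y * \1_(h n @^-1` [set y]) x)%:E))%E.
  by apply: eq_integral => t tE; rewrite /= fimfunE -fsumEFin.
transitivity (\int[mu]_x (\sum_(y \in range (h n))
    (y * \1_(h n @^-1` [set y]) x)%:E * (p x)%:E))%E; last first.
  apply: eq_integral => x _.
  rewrite -ge0_mule_fsuml => [|y]; last exact: nnfun_muleindic_ge0.
  by rewrite fsumEFin // -(fimfunE _ x).
have indich r : measurable_fun [set: T] (fun x => (r * \1_(h n @^-1` [set r]) x)%:E).
  by apply/measurable_EFinP; exact: measurable_funM.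
rewrite ge0_integral_fsum//; last by move=> m y _; exact: nnfun_muleindic_ge0.
rewrite ge0_integral_fsum//; last 2 first.
  - by move=> y; apply: emeasurable_funM.
  - move=> m y _; apply: mule_ge0; last by rewrite lee_fin.
    exact: nnfun_muleindic_ge0.
apply: eq_fsbigr => r rhn.
under [LHS]eq_integral do rewrite EFinM.
rewrite integralZl_indic_nnsfun//.
under [RHS]eq_integral do rewrite EFinM -muleA.
rewrite ge0_integralZl//.
- under [in RHS]eq_integral do rewrite indicp.
  by rewrite -integral_mkcond -nuE// integral_indic// setIT.
- by apply: emeasurable_funM => //; exact/measurable_EFinP.
- by move=> t _; rewrite mule_ge0 ?lee_fin.
- by move: rhn; rewrite inE => -[t _ <-]; rewrite lee_fin.
Qed.

End density.

(** The joint law of [X] and [Y] agrees with the product of the marginal laws on rectangles, hence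
    everywhere, and Tonelli separates the integral. *)
Lemma ge0_integral_independent {dO d} {Omega : measurableType dO} {T : measurableType d}
    {R : realType} (P : probability Omega R) (X Y : Omega -> T) (f g : T -> \bar R) :
  measurable_fun [set: Omega] X -> measurable_fun [set: Omega] Y ->
  (forall A B, measurable A -> measurable B ->
     P (X @^-1` A `&` Y @^-1` B) = P (X @^-1` A) * P (Y @^-1` B))%E ->
  measurable_fun [set: T] f -> measurable_fun [set: T] g ->
  (forall x, 0 <= f x)%E -> (forall x, 0 <= g x)%E ->
  (\int[P]_o (f (X o) * g (Y o)) = \int[P]_o f (X o) * \int[P]_o g (Y o))%E.
Proof.
move=> mX mY XY mf mg f0 g0.
pose X' : {mfun Omega >-> T} := HB.pack X (isMeasurableFun.Build _ _ _ _ X mX).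
pose Y' : {mfun Omega >-> T} := HB.pack Y (isMeasurableFun.Build _ _ _ _ Y mY).
pose h (z : T * T) : \bar R := (f z.1 * g z.2)%E.
pose XYp o := (X o, Y o).
have mXY : measurable_fun [set: Omega] XYp by exact: measurable_fun_pair.
have mh : measurable_fun [set: T * T] h.
  by apply: emeasurable_funM; [exact: measurableT_comp mf _|exact: measurableT_comp mg _].
have h0 z : (0 <= h z)%E by rewrite mule_ge0.
transitivity (\int[pushforward P XYp]_z h z)%E.
  by rewrite ge0_integral_pushforward.
transitivity (\int[distribution P X' \x distribution P Y']_z h z)%E.
  apply: eq_measure_integral => A mA _; apply/esym.
  exact: product_measure_unique.
rewrite fubini_tonelli1//.
transitivity (\int[distribution P X']_x (f x * \int[distribution P Y']_y g y))%E.
  by apply: eq_integral => x _; rewrite /fubini_F /h/= ge0_integralZl.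
rewrite ge0_integralZr//; last exact: integral_ge0.
by rewrite !ge0_integral_distribution.
Qed.

(** The second moment may be infinite. The identity [(F - e)^2 + 2eF = F^2 + e^2] is therefore
    integrated with non-negative terms on both sides, and only finite constants are cancelled
    afterwards. *)
Lemma varianceD_sqr_ge0 {d} {T : measurableType d} {R : realType}
    (P : probability T R) (F : T -> R) (e : R) :
  measurable_fun [set: T] F -> (forall x, 0 <= F x) -> 0 <= e ->
  (\int[P]_x (F x)%:E = e%:E)%E ->
  ('V_P[F] = \int[P]_x (F x ^+ 2)%:E - (e ^+ 2)%:E)%E.
Proof.
move=> mF F0 e0 FE.
have VE : ('V_P[F] = \int[P]_x ((F x - e) ^+ 2)%:E)%E.
  by rewrite /variance unlock unlock FE; apply: eq_integral.
have mFe : measurable_fun [set: T] (fun x => ((F x - e) ^+ 2)%:E).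
  by apply/measurable_EFinP/measurable_funX/measurable_funB.
have mF2 : measurable_fun [set: T] (fun x => (F x ^+ 2)%:E).
  exact/measurable_EFinP/measurable_funX.
have mFE : measurable_fun [set: T] (fun x => (F x)%:E) by exact/measurable_EFinP.
have V2 : ('V_P[F] + (2 * e * e)%:E = \int[P]_x (F x ^+ 2)%:E + (e ^+ 2)%:E)%E.
  rewrite VE.
  have -> : ((2 * e * e)%:E = \int[P]_x ((2 * e)%:E * (F x)%:E))%E.
    rewrite ge0_integralZl_EFin ?FE// ?mulr_ge0// => x _.
    by rewrite lee_fin.
  have -> : ((e ^+ 2)%:E = \int[P]_x cst (e ^+ 2)%:E x)%E.
    by rewrite integral_cst// [X in (_ * X)%E](@probability_setT _ _ _ P) mule1.
  rewrite -!ge0_integralD//.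
  - by apply: eq_integral => x _; rewrite -!EFinM -!EFinD; congr EFin; ring.
  - by move=> x _; rewrite lee_fin sqr_ge0.
  - by move=> x _; rewrite lee_fin sqr_ge0.
  - by move=> x _; rewrite lee_fin sqr_ge0.
  - by move=> x _; rewrite -EFinM lee_fin !mulr_ge0.
  - exact: measurable_funeM.
rewrite -[LHS](@addeK _ (2 * e * e)%:E)// V2 -addeA -EFinN -EFinD; congr (_ + _)%E.
by rewrite -EFinN; congr EFin; ring.
Qed.

Lemma sume_const {R : realDomainType} {N : nat} (x : \bar R) :
  (0 <= x)%E -> (\sum_(t < N) x = N%:R%:E * x)%E.
Proof.
move=> x0; transitivity (\sum_(t < N) (1%:E * x))%E.
  by apply: eq_bigr => t _; rewrite mul1e.
by rewrite -ge0_sume_distrl// sumEFin sumr_const card_ord.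
Qed.

(** Squaring the sum gives [N] diagonal terms [s] and [N(N-1)] mixed terms [e ^+ 2]. The value [s]
    is an extended real, so an infinite second moment is covered. *)
Lemma variance_mean {d} {T : measurableType d} {R : realType} {N : nat}
    (P : probability T R) (Y : 'I_N -> T -> R) (e : R) (s : \bar R) :
  (0 < N)%N -> 0 <= e -> (forall t, measurable_fun [set: T] (Y t)) -> (forall t x, 0 <= Y t x) ->
  (forall t, \int[P]_x (Y t x)%:E = e%:E)%E ->
  (forall t, \int[P]_x (Y t x ^+ 2)%:E = s)%E ->
  (forall t u, t != u -> \int[P]_x (Y t x * Y u x)%:E = (e ^+ 2)%:E)%E ->
  ('V_P[fun x => (N%:R^-1 * \sum_t Y t x)%R] = N%:R^-1%:E * s - (e ^+ 2 / N%:R)%:E)%E.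
Proof.
move=> N0 e0 mY Y0 Ye Ys Ytu.
have N_gt0 : 0 < N%:R :> R by rewrite ltr0n.
have N_neq0 : N%:R != 0 :> R by rewrite gt_eqF.
have s0 : (0 <= s)%E.
  by rewrite -(Ys (Ordinal N0)); apply: integral_ge0 => x _; rewrite lee_fin sqr_ge0.
have mYE t : measurable_fun [set: T] (fun x => (Y t x)%:E) by exact/measurable_EFinP.
have mYY t u : measurable_fun [set: T] (fun x => (Y t x * Y u x)%:E).
  by apply/measurable_EFinP; exact: measurable_funM.
rewrite (varianceD_sqr_ge0 P _ e)//; last 3 first.
- by apply: measurable_funM => //; exact: measurable_sum.
- by move=> x; rewrite mulr_ge0 ?invr_ge0 ?sumr_ge0.
- under eq_integral do rewrite EFinM -sumEFin.
  rewrite ge0_integralZl_EFin//; last 2 first.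
  + by move=> x _; rewrite sumEFin lee_fin sumr_ge0.
  + exact: emeasurable_sum.
  rewrite ge0_integral_sum//; last by move=> t x _; rewrite lee_fin.
  under eq_bigr do rewrite Ye.
  by rewrite sumEFin sumr_const card_ord -EFinM -[e *+ N]mulr_natl mulKf.
have -> : (\int[P]_x ((N%:R^-1 * \sum_t Y t x) ^+ 2)%:E =
    (N%:R ^- 2)%:E * \sum_t \sum_u \int[P]_x (Y t x * Y u x)%:E)%E.
  have -> : (\sum_t \sum_u \int[P]_x (Y t x * Y u x)%:E =
      \int[P]_x (\sum_t \sum_u (Y t x * Y u x)%:E))%E.
    rewrite ge0_integral_sum//; last 2 first.
    - by move=> t; exact: emeasurable_sum.
    - by move=> t x _; apply: sume_ge0 => u _; rewrite lee_fin mulr_ge0.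
    apply: eq_bigr => t _; rewrite ge0_integral_sum// => u x _.
    by rewrite lee_fin mulr_ge0.
  rewrite -ge0_integralZl_EFin//; last 2 first.
  + by move=> x _; apply: sume_ge0 => t _; apply: sume_ge0 => u _; rewrite lee_fin mulr_ge0.
  + by apply: emeasurable_sum => t; exact: emeasurable_sum.
  apply: eq_integral => x _.
  rewrite exprMn exprVn EFinM; congr (_ * _)%E.
  rewrite (eq_bigr (fun t => (Y t x * \sum_u Y u x)%:E)); last first.
    by move=> t _; rewrite sumEFin -mulr_sumr.
  by rewrite sumEFin -mulr_suml expr2.
have -> : (\sum_t \sum_u \int[P]_x (Y t x * Y u x)%:E =
    N%:R%:E * (s + ((N.-1)%:R * e ^+ 2)%:E))%E.
  rewrite -sume_const; last by rewrite adde_ge0// lee_fin mulr_ge0// sqr_ge0.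
  apply: eq_bigr => t _; rewrite (bigD1 t)//=; congr (_ + _)%E.
    by rewrite -(Ys t); apply: eq_integral => x _; rewrite expr2.
  under eq_bigr => u tu do rewrite Ytu 1?eq_sym//.
  rewrite sumEFin sumr_const -[(e ^+ 2) *+ _]mulr_natl; congr (_%:R * _)%:E.
  by rewrite (cardC1 t) card_ord.
rewrite muleA -EFinM.
have -> : N%:R ^- 2 * N%:R = N%:R^-1 :> R by field.
rewrite ge0_muleDr//; last by rewrite lee_fin mulr_ge0// sqr_ge0.
rewrite -addeA -EFinM -!EFinN -EFinD; congr (_ + _%:E)%E.
have -> : (N.-1)%:R = N%:R - 1 :> R by rewrite -subn1 natrB.
by field.
Qed.

(** * The Gaussian mixture and the moments of the contribution of one draw *)

Lemma measurable_mixture {R : realType} {n K : nat} (a : 'I_K -> R)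
    (m : 'I_K -> 'rV[R]_n) (S : 'I_K -> 'M[R]_n) :
  measurable_fun [set: Rvec R n] (fun x : Rvec R n => mixture a m S x).
Proof.
apply: measurable_sum => k; apply: measurable_funM => //; exact: measurable_MVN.
Qed.

Lemma MVN_gt0 {R : realType} {n : nat} (x m : 'rV[R]_n) (S : 'M[R]_n) :
  0 < \det S -> 0 < MVN x m S.
Proof.
move=> S0; rewrite mulr_gt0 ?expR_gt0// invr_gt0 sqrtr_gt0 mulr_gt0//.
by rewrite exprn_gt0// mulr_gt0// pi_gt0.
Qed.

Lemma mixture_gt0 {R : realType} {n K : nat} (a : 'I_K -> R)
    (m : 'I_K -> 'rV[R]_n) (S : 'I_K -> 'M[R]_n) (x : 'rV[R]_n) :
  (0 < K)%N -> (forall k, 0 < a k) -> (forall k, 0 < \det (S k)) -> 0 < mixture a m S x.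
Proof.
case: K a m S => // K a m S _ a0 S0; rewrite /mixture (bigD1 ord0)//=.
apply: ltr_wpDr; last by rewrite mulr_gt0 ?MVN_gt0.
by apply: sumr_ge0 => k _; rewrite mulr_ge0 ?MVN_ge0// ltW.
Qed.

Lemma measurable_inv_pos {d} {T : measurableType d} {R : realType} (f : T -> R) :
  (forall x, 0 <= f x) -> measurable_fun [set: T] f ->
  measurable_fun [set: T] (fun x => (f x)^-1).
Proof.
move=> f0 mf; under [fun _ => _]eq_fun do rewrite -powR_inv1//.
exact: measurableT_comp (measurable_powR _) _.
Qed.

(* The contribution of one draw to the estimator, with pi L replaced by Z times the posterior. *)
Definition hme_summand {R : realType} {n K : nat}
    (lam : {measure set (Rvec R n) -> \bar R}) (Z : R) (a : 'I_K -> R)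
    (m : 'I_K -> 'rV[R]_n) (S : 'I_K -> 'M[R]_n) (w : 'I_K -> R)
    (A : 'I_K -> set (Rvec R n)) (x : Rvec R n) : R :=
  (\sum_k w k * (fine (lam (A k)))^-1 * \1_(A k) x) * (Z * mixture a m S x)^-1.

Section summand_moments.
Context {R : realType} {n K : nat} (lam : {measure set (Rvec R n) -> \bar R}) (Z : R)
  (a : 'I_K -> R) (m : 'I_K -> 'rV[R]_n) (S : 'I_K -> 'M[R]_n) (w : 'I_K -> R)
  (A : 'I_K -> set (Rvec R n)).
Hypotheses (K0 : (0 < K)%N) (Z0 : 0 < Z) (a0 : forall k, 0 < a k)
  (S0 : forall k, 0 < \det (S k)) (admA : admissible lam w A).

Let p := mixture a m S.
Let f := hme_summand lam Z a m S w A.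
Let v k := fine (lam (A k)).

Let p0 x : 0 < p x. Proof. exact: mixture_gt0. Qed.
Let Zp0 x : 0 < Z * p x. Proof. by rewrite mulr_gt0. Qed.
Let w0 k : 0 <= w k. Proof. by case: admA. Qed.
Let mA k : measurable (A k). Proof. by case: admA => _ [_ /(_ k)[]]. Qed.
Let v0 k : 0 < v k.
Proof. by case: admA => _ [_ /(_ k)[_ [? ?]]]; rewrite fine_gt0//; apply/andP. Qed.
Let vE k : lam (A k) = (v k)%:E.
Proof. by case: admA => _ [_ /(_ k)[_ [? ?]]]; rewrite fineK// ge0_fin_numE. Qed.
Let mind k : measurable_fun [set: Rvec R n] (\1_(A k) : Rvec R n -> R).
Proof. exact: measurable_indic. Qed.

Lemma measurable_hme_summand : measurable_fun [set: Rvec R n] f.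
Proof.
apply: measurable_funM.
  by apply: measurable_sum => k; apply: measurable_funM.
apply: measurable_inv_pos => [x|]; first exact: ltW (Zp0 x).
by apply: measurable_funM => //; exact: measurable_mixture.
Qed.

Lemma hme_summand_ge0 x : 0 <= f x.
Proof.
apply: mulr_ge0; last by rewrite invr_ge0; exact: ltW (Zp0 x).
by apply: sumr_ge0 => k _; rewrite !mulr_ge0 ?invr_ge0// ltW.
Qed.

(** The posterior density cancels, component [k] integrates to [w k / Z] because its indicator is
    divided by the volume of [A k], and the weights sum to 1. *)
Lemma hme_summand_mean : (\int[lam]_x ((f x)%:E * (p x)%:E) = (Z^-1)%:E)%E.
Proof.
transitivity (\int[lam]_x \sum_k ((w k * (v k)^-1 * Z^-1)%:E * (\1_(A k) x)%:E))%E.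
  apply: eq_integral => x _; rewrite -EFinM (eq_bigr (fun k =>
     (w k * (v k)^-1 * \1_(A k) x * Z^-1)%:E)); last first.
    by move=> k _; rewrite -EFinM mulrAC.
  rewrite sumEFin -mulr_suml; congr EFin.
  by rewrite /f /hme_summand -/p invfM [X in X * _ = _]mulrA divfK ?gt_eqF.
have c0 k : 0 <= w k * (v k)^-1 * Z^-1 by rewrite !mulr_ge0 ?invr_ge0// ltW.
rewrite ge0_integral_sum//; last 2 first.
- move=> k; apply: measurable_funeM; exact/measurable_EFinP.
- by move=> k x _; rewrite mule_ge0 ?lee_fin.
rewrite (eq_bigr (fun k => (w k * Z^-1)%:E)) => [|k _].
  by rewrite sumEFin -mulr_suml; case: admA => _ [-> _]; rewrite mul1r.
rewrite ge0_integralZl_EFin//; last exact/measurable_EFinP.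
rewrite integral_indic// setIT vE -EFinM; congr EFin.
by field; rewrite !gt_eqF//.
Qed.

(** Pointwise, [f ^+ 2 * p] is [(\sum_k b k) ^+ 2 / (Z ^+ 2 * p)] with [p] the sum of the [q k], so
    Cauchy-Schwarz bounds it by [Z ^- 2] times the sum of [b k ^+ 2 / q k]. This carries no factor
    [K]. *)
Lemma hme_summand_second_moment :
  (\int[lam]_x ((f x ^+ 2)%:E * (p x)%:E) <= (Z ^- 2)%:E *
    \sum_k (w k ^+ 2 / a k)%:E * inv_density_ratio lam (m k) (S k) (A k))%E.
Proof.
pose h k (x : Rvec R n) : \bar R := ((v k) ^- 2 / MVN x (m k) (S k))%:E.
have h0 k x : (0 <= h k x)%E.
  by rewrite lee_fin divr_ge0 ?MVN_ge0// invr_ge0 sqr_ge0.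
have mh k : measurable_fun [set: Rvec R n] (h k).
  apply/measurable_EFinP; apply: measurable_funM => //; exact: measurable_MVN_inv.
have c0 k : 0 <= w k ^+ 2 / a k by rewrite divr_ge0 ?sqr_ge0// ltW.
have hA0 k x : (0 <= (h k \_ (A k)) x)%E by exact: erestrict_ge0.
have mhA k : measurable_fun [set: Rvec R n] (h k \_ (A k)).
  by apply/(measurable_restrictT _ (mA k)); exact: measurable_funTS.
have -> : ((Z ^- 2)%:E * \sum_k (w k ^+ 2 / a k)%:E * inv_density_ratio lam (m k) (S k) (A k)
   = \int[lam]_x ((Z ^- 2)%:E * \sum_k ((w k ^+ 2 / a k)%:E * (h k \_ (A k)) x)))%E.
  have t0 k x : (0 <= (w k ^+ 2 / a k)%:E * (h k \_ (A k)) x)%E by rewrite mule_ge0 ?lee_fin.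
  rewrite ge0_integralZl_EFin//; last 3 first.
  - by move=> x _; apply: sume_ge0.
  - by apply: emeasurable_sum => k; exact: measurable_funeM.
  - by rewrite invr_ge0 sqr_ge0.
  rewrite ge0_integral_sum//; last by move=> k; exact: measurable_funeM.
  congr (_ * _)%E; apply: eq_bigr => k _.
  by rewrite ge0_integralZl_EFin// /inv_density_ratio [in LHS]integral_mkcond.
apply: ge0_le_integral => //.
- by move=> x _; rewrite -EFinM lee_fin mulr_ge0 ?sqr_ge0// ltW.
- apply: emeasurable_funM; apply/measurable_EFinP.
    by apply: measurable_funX; exact: measurable_hme_summand.
  exact: measurable_mixture.
- by apply: measurable_funeM; apply: emeasurable_sum => k; exact: measurable_funeM.
move=> x _.
pose b k : R := w k * (v k)^-1 * \1_(A k) x.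
pose q k : R := a k * MVN x (m k) (S k).
have q0 k : 0 < q k by rewrite mulr_gt0// MVN_gt0.
have cs := sum_sqr_le b q q0.
rewrite (eq_bigr (fun k => (b k ^+ 2 / q k)%:E)) => [|k _]; last first.
  rewrite epatch_indic -!EFinM; congr EFin.
  have i2 : \1_(A k) x ^+ 2 = \1_(A k) x :> R.
    by rewrite indicE; case: (_ \in _); rewrite ?expr1n// expr0n.
  rewrite /b /q !exprMn i2 exprVn (invfM (a k)).
  by move: (a k)^-1 (MVN _ _ _)^-1 (v k ^+ 2)^-1 => *; ring.
rewrite sumEFin -!EFinM lee_fin.
rewrite /f /hme_summand -/p -/(\sum_k b k) exprMn exprVn exprMn invfM.
rewrite mulrCA -!mulrA ler_wpM2l ?invr_ge0 ?sqr_ge0//.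
rewrite expr2 invfM -mulrA mulVf ?gt_eqF// mulr1.
by rewrite mulrA -expr2 ler_pdivrMr.
Qed.

End summand_moments.

(** * Law and independence of the draws, and the comparison of bounds *)

Lemma ge0_integral_law {R : realType} {dO d} {Omega : measurableType dO}
    {T : measurableType d} (P : probability Omega R) (mu : {measure set T -> \bar R})
    (X : Omega -> T) (p : T -> R) (g : T -> \bar R) :
  measurable_fun [set: Omega] X -> measurable_fun [set: T] p -> (forall x, 0 <= p x) ->
  (forall B, measurable B -> P (X @^-1` B) = \int[mu]_(x in B) (p x)%:E)%E ->
  measurable_fun [set: T] g -> (forall x, 0 <= g x)%E ->
  (\int[P]_o g (X o) = \int[mu]_x (g x * (p x)%:E))%E.
Proof.
move=> mX mp p0 PX mg g0.
pose X' : {mfun Omega >-> T} := HB.pack X (isMeasurableFun.Build _ _ _ _ X mX).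
rewrite -(ge0_integral_density mu (distribution P X'))//.
by rewrite ge0_integral_distribution.
Qed.

Lemma mutually_independent_pair {R : realType} {dO} {Omega : measurableType dO} {n N : nat}
    (P : probability Omega R) (X : 'I_N -> Omega -> Rvec R n) (t u : 'I_N)
    (A B : set (Rvec R n)) :
  mutually_independent P X -> t != u -> measurable A -> measurable B ->
  P (X t @^-1` A `&` X u @^-1` B) = (P (X t @^-1` A) * P (X u @^-1` B))%E.
Proof.
move=> indX tu mA mB.
(* The whole space is taken at every index other than [t] and [u], so those factors of the product
   are 1. *)
pose C i : set (Rvec R n) := if i == t then A else if i == u then B else setT.
have Ct : C t = A by rewrite /C eqxx.
have Cu : C u = B by rewrite /C eqxx eq_sym (negbTE tu).
have mC i : measurable (C i) by rewrite /C; case: eqP => // _; case: eqP.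
have := indX C mC; rewrite (bigD1 t)//= (bigD1 u) 1?eq_sym//= big1 => [|i /andP[it iu]]; last first.
  by rewrite /C (negbTE it) (negbTE iu) preimage_setT probability_setT.
rewrite mule1 Ct Cu => <- //; congr (P _); apply/seteqP; split => [x [xA xB] i _|x H].
  by rewrite /C /=; case: eqP => [->//|_]; case: eqP => [->|].
by split; [have := H t I; rewrite Ct | have := H u I; rewrite Cu].
Qed.

Lemma ge0_sum_EFin_distrl {R : realDomainType} {I : finType} (c : I -> R) (x : \bar R) :
  (forall k, 0 <= c k) -> (\sum_k (c k)%:E * x = (\sum_k c k)%:E * x)%E.
Proof. by move=> c0; rewrite -sumEFin ge0_sume_distrl// => k _; rewrite lee_fin. Qed.

Theorem theorem3
  (R : realType) (n : nat) (hn : (0 < n)%N)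
  (lam : {measure set (Rvec R n) -> \bar R}) (hlam : is_lebesgue lam)
  (cR : R) (hcR0 : 0 < cR)
  (hcR : forall c : R, 0 < c -> (cR_objective lam cR <= cR_objective lam c)%E)
  (K : nat) (a : 'I_K -> R) (m : 'I_K -> 'rV[R]_n) (S : 'I_K -> 'M[R]_n)
  (ha : forall k, 0 < a k) (ha1 : \sum_(k < K) a k = 1)
  (hS : forall k, posdef (S k))
  (pi_ L : Rvec R n -> R) (Z : R) (hZ0 : 0 < Z)
  (hZ : Z%:E = (\int[lam]_x (pi_ x * L x)%:E)%E)
  (hpost : forall x : Rvec R n, pi_ x * L x / Z = mixture a m S x)
  (T : nat) (hT : (0 < T)%N) (hTeven : ~~ odd T)
  {dO : measure_display} (Omega : measurableType dO) (P : probability Omega R)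
  (X : 'I_(T./2) -> Omega -> Rvec R n)
  (hXmeas : forall t, measurable_fun [set: Omega] (X t))
  (hXdist : forall t (B : set (Rvec R n)), measurable B ->
     P (X t @^-1` B) = (\int[lam]_(x in B) (mixture a m S x)%:E)%E)
  (hXind : mutually_independent P X) :
  (forall (w : 'I_K -> R) (A : 'I_K -> set (Rvec R n)),
     admissible lam w A ->
     ('V_P[Zinv_mix lam (fun x => (pi_ x * L x)%R) w A X]
        <= Ubound T./2 lam Z a m S w A)%E)
  /\ admissible lam a (fun k => ellipsoid (m k) (S k) cR)
  /\ (forall (w : 'I_K -> R) (A : 'I_K -> set (Rvec R n)),
     admissible lam w A ->
     (Ubound T./2 lam Z a m S a (fun k => ellipsoid (m k) (S k) cR)
        <= Ubound T./2 lam Z a m S w A)%E).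
Proof.
have K0 : (0 < K)%N.
  by rewrite lt0n; apply: contra_eqN ha1 => /eqP K0; subst K; rewrite big_ord0 eq_sym oner_neq0.
(* Evenness excludes [T = 1], whose half would be 0. *)
have N0 : (0 < T./2)%N by rewrite half_gt0; case: (T) hT hTeven => [|[]].
have detS k : 0 < \det (S k) by have [] := whitening_map lam (m k) (S k) hlam (hS k).
have J0 k A : (0 <= inv_density_ratio lam (m k) (S k) A)%E.
  by apply: integral_ge0 => x _; rewrite lee_fin divr_ge0 ?MVN_ge0// invr_ge0 sqr_ge0.
have wa0 (w : 'I_K -> R) k : 0 <= w k ^+ 2 / a k by rewrite divr_ge0 ?sqr_ge0// ltW.
have admE : admissible lam a (fun k => ellipsoid (m k) (S k) cR).
  split => [k|]; first exact: ltW.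
  split => // k; have [v v0 vE] := ellipsoid_volume lam (m k) (S k) hlam (hS k).
  split; first exact: measurable_ellipsoid.
  by rewrite vE// lte_fin ltry mulr_gt0// exprn_gt0.
split; last split => // w A adm.
  move=> w A adm.
  pose f := hme_summand lam Z a m S w A.
  have mf : measurable_fun [set: Rvec R n] f.
    exact: measurable_hme_summand.
  have f0 x : 0 <= f x by exact: hme_summand_ge0.
  have p0 x : 0 <= mixture a m S x by apply: ltW; exact: mixture_gt0.
  have law t g (mg : measurable_fun [set: Rvec R n] g) (g0 : forall x, (0 <= g x)%E) :=
    ge0_integral_law P lam (X t) (mixture a m S) g (hXmeas t)
      (measurable_mixture a m S) p0 (hXdist t) mg g0.
  have mfE : measurable_fun [set: Rvec R n] (fun x => (f x)%:E) by exact/measurable_EFinP.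
  have mf2 : measurable_fun [set: Rvec R n] (fun x => (f x ^+ 2)%:E).
    by apply/measurable_EFinP; exact: measurable_funX.
  have Ef t : (\int[P]_o (f (X t o))%:E = (Z^-1)%:E)%E.
    by rewrite (law t (fun x => (f x)%:E))//; exact: hme_summand_mean.
  (* Exchanging the sums over components and draws exhibits the estimator as a mean of the variables
     [f (X t o)]. *)
  have ZE : Zinv_mix lam (fun x => (pi_ x * L x)%R) w A X =
      fun o => (T./2)%:R^-1 * \sum_t f (X t o).
    have piLE x : pi_ x * L x = Z * mixture a m S x.
      by rewrite -hpost [RHS]mulrC divfK ?gt_eqF.
    apply/funext => o; rewrite /Zinv_mix /f /hme_summand.
    under [in RHS]eq_bigr do rewrite mulr_suml.
    rewrite exchange_big/= mulr_sumr; apply: eq_bigr => k _.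
    rewrite mulrCA; congr (_ * _); rewrite big_mkcond mulr_sumr; apply: eq_bigr => t _.
    rewrite indicE piLE /in_mem/= /in_set.
    by case: ifP => _; rewrite ?mulr0 ?mul0r// mulr1 mulrA.
  rewrite ZE (variance_mean P _ Z^-1 (\int[lam]_x ((f x ^+ 2)%:E * (mixture a m S x)%:E))%E)//.
  - rewrite exprVn /Ubound; apply: leeB => //.
    have sumJ0 : (0 <= \sum_(k < K) (w k ^+ 2 / a k)%:E *
        inv_density_ratio lam (m k) (S k) (A k))%E.
      by apply: sume_ge0 => k _; rewrite mule_ge0 ?lee_fin.
    (* The second-moment estimate gives the bound without the factor [K], which is then inserted
       using [1 <= K]. *)
    apply: (@le_trans _ _ ((T./2)%:R^-1%:E * ((Z ^- 2)%:E * \sum_(k < K)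
        (w k ^+ 2 / a k)%:E * inv_density_ratio lam (m k) (S k) (A k))))%E.
      apply: lee_wpmul2l; first by rewrite lee_fin invr_ge0.
      exact: hme_summand_second_moment.
    rewrite muleA -EFinM; apply: lee_wpmul2r => //.
    rewrite lee_fin mulrC ler_wpM2r ?invr_ge0//.
    by rewrite ler_peMl ?invr_ge0 ?sqr_ge0// ler1n.
  - by rewrite invr_ge0 ltW.
  - by move=> t; exact: measurableT_comp mf (hXmeas t).
  - by move=> t; rewrite (law t (fun x => (f x ^+ 2)%:E))// => x; rewrite lee_fin sqr_ge0.
  - move=> t u tu; under eq_integral do rewrite EFinM.
    rewrite (ge0_integral_independent P (X t) (X u) (EFin \o f) (EFin \o f))//=.
      by rewrite !Ef -EFinM expr2.
    by move=> A' B' mA' mB'; exact: mutually_independent_pair.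
rewrite /Ubound; apply: leeB => //; apply: lee_wpmul2l.
  by rewrite lee_fin divr_ge0 ?mulr_ge0 ?invr_ge0 ?sqr_ge0.
set J := cR_objective lam cR.
have obj0 : (0 <= J)%E.
  by apply: integral_ge0 => x _; rewrite lee_fin divr_ge0 ?MVN_ge0// invr_ge0 sqr_ge0.
(* At the proposed optimum every component has the same value [J] and coefficient
   [a k ^+ 2 / a k = a k], so the sum equals [J]. *)
apply: (@le_trans _ _ J).
  rewrite le_eqVlt; apply/orP; left; apply/eqP.
  rewrite -[RHS]mul1e -ha1 -(ge0_sum_EFin_distrl a J (fun k => ltW (ha k))).
  apply: eq_bigr => k _; rewrite /J -(inv_density_ratio_ellipsoid lam (m k) (S k))//.
  by rewrite expr2 mulfK ?gt_eqF.
(* The weights and the sets are compared separately: first the coefficients sum to at least 1 by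
   Cauchy-Schwarz, then [J] bounds each component integral from below. *)
apply: (@le_trans _ _ (\sum_(k < K) (w k ^+ 2 / a k)%:E * J)%E).
  rewrite (ge0_sum_EFin_distrl (fun k => w k ^+ 2 / a k) J)// -[leLHS]mul1e.
  apply: lee_wpmul2r => //; rewrite lee_fin.
  have := sum_sqr_le w a ha; rewrite ha1 mulr1.
  by case: adm => _ [-> _]; rewrite expr1n.
apply: lee_sum => k _; apply: lee_wpmul2l; first by rewrite lee_fin.
have [_ [_ /(_ k)[mA [A0 Afin]]]] := adm.
exact: inv_density_ratio_min.
Qed.
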